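(* (1) For every compact metric space $(X, d)$ there is a countable ordinal $\alpha$ such that the canonical projection $\pi_{\alpha}^{\alpha + 1}\colon X^{(\alpha)}\to X^{(\alpha+1)}$ is an isometry. (2) If $(X, d)$ is a compact metric space and $\alpha$ is a countable ordinal such that $\pi_{\alpha}^{\alpha + 1}$ is an isometry, then for all ordinals $\beta,\gamma$ with $\alpha \leqslant \beta \leqslant \gamma$ the canonical projection $\pi_{\beta}^{\gamma}\colon X^{(\beta)}\to X^{(\gamma)}$ is an isometry. In particular, $(X^{(\alpha)}, d^{(\alpha)})$ is iso-rigid.
   Context: For a compact metric space $(X,d)$, let $\mathrm{Iso}(X,d)$ be the set of all isometries of $X$ onto itself, and let $x\sim y$ iff $\varphi(x)=y$ for some $\varphi\in\mathrm{Iso}(X,d)$. The iso-derivative $(X^{(1)},d^{(1)})$ is the quotient set $X^{(1)}=X/{\sim}$ with the greatest pseudometric $d^{(1)}$ making the canonical projection $\pi_X^{(1)}\colon X\to X^{(1)}$ non-expansive (i.e. 1-Lipschitz); $d^{(1)}$ is known to be a metric, so $(X^{(1)},d^{(1)})$ is a compact metric space. $(X,d)$ is iso-rigid if $(X^{(1)},d^{(1)})=(X,d)$ (identified up to isometry). The transfinite sequence of iso-derivatives $(X^{(\alpha)},d^{(\alpha)})$ and canonical projections $\pi_\beta^\gamma\colon X^{(\beta)}\to X^{(\gamma)}$ ($\beta\leqslant\gamma$) is defined by transfinite recursion. $X^{(0)}=X$, $\pi_0^0=\mathrm{id}_X$. At successors, $(X,d)^{(\alpha+1)}=(X^{(\alpha)},d^{(\alpha)})^{(1)}$,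 $\pi_\beta^{\alpha+1}=\pi_{X^{(\alpha)}}^{(1)}\circ\pi_\beta^\alpha$ for $\beta\leqslant\alpha$, and $\pi_{\alpha+1}^{\alpha+1}=\mathrm{id}$. At a limit ordinal $\alpha$, $((X,d)^{(\alpha)},\{\pi_\beta^\alpha\}_{\beta<\alpha})$ is the inductive limit (direct limit/colimit, which exists and is unique up to isometry), in the category of compact metric spaces and non-expansive mappings, of the direct system $(\{(X^{(\beta)},d^{(\beta)})\}_{\beta<\alpha},\{\pi_\beta^\gamma\}_{\beta\leqslant\gamma<\alpha})$, and $\pi_\alpha^\alpha=\mathrm{id}$. Countable ordinals include finite ones. *)

(* Defs.v *)
From HB Require Import structures.
From mathcomp Require Import all_boot all_order all_algebra.
From mathcomp Require Import all_classical all_reals topology wochoice.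
From mathcomp Require Import generic_quotient.

Set Implicit Arguments.
Unset Strict Implicit.
Unset Printing Implicit Defensive.

Import Order.TTheory GRing.Theory Num.Theory.
Local Open Scope classical_set_scope.
Local Open Scope ring_scope.

(* An ordinal is represented by an element [a] of a well-ordered type [W]: it
   is the order type of [[set b | b < a]]. Every ordinal arises this way, and
   an uncountable [W] contains every countable ordinal. *)

Record compactMetric (R : realType) := CompactMetric {
  cm_sort :> metricType R;
  cm_compact : compact [set: cm_sort]
}.

Section IsoDerivative.
Context {R : realType}.

Definition nonexpansive (X Y : metricType R) (f : X -> Y) : Prop :=
  forall x y, mdist (f x) (f y) <= mdist x y.

Definition is_isometry (X Y : metricType R) (f : X -> Y) : Prop :=
  (forall x y, mdist (f x) (f y) = mdist x y) /\
  (forall y, exists x, f x = y).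

Definition iso_equiv (X : metricType R) (x y : X) : Prop :=
  exists phi : X -> X, is_isometry phi /\ phi x = y.

Definition pseudometric (T : Type) (rho : T -> T -> R) : Prop :=
  [/\ forall x, rho x x = 0,
      forall x y, rho x y = rho y x &
      forall x y z, rho x z <= rho x y + rho y z].

(* The first two conditions say that [p] is, up to a bijection of [Y], the
   canonical projection of [X] onto the quotient set [X / iso_equiv]; the last
   two that the distance of [Y] is the greatest pseudometric on that set
   making [p] non-expansive. *)
Definition is_iso_derivative (X Y : metricType R) (p : X -> Y) : Prop :=
  [/\ forall y, exists x, p x = y,
      forall x x', p x = p x' <-> iso_equiv x x',
      nonexpansive p &
      forall rho : Y -> Y -> R, pseudometric rho ->
        (forall x x', rho (p x) (p x') <= mdist x x') ->
        forall y y', rho y y' <= mdist y y'].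

Definition iso_rigid (X : compactMetric R) : Prop :=
  exists (Y : compactMetric R) (p : X -> Y),
    is_iso_derivative p /\ exists f : X -> Y, is_isometry f.

Record directSystem {d : Order.disp_t} (W : orderType d) := DirectSystem {
  ds_space :> W -> compactMetric R;
  ds_proj : forall b c, (b <= c)%O -> ds_space b -> ds_space c;
  ds_proj_nonexpansive : forall b c (bc : (b <= c)%O),
    nonexpansive (ds_proj bc);
  ds_proj_id : forall b (bb : (b <= b)%O) x, ds_proj bb x = x;
  ds_proj_comp : forall a b c (ab : (a <= b)%O) (bc : (b <= c)%O)
    (ac : (a <= c)%O) x, ds_proj bc (ds_proj ab x) = ds_proj ac x
}.

Arguments ds_proj {d W} S {b c} bc x : rename.

Section Transfinite.
Context {d : Order.disp_t} {W : orderType d}.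
Implicit Types (S : directSystem W) (a b c : W).

Definition is_cocone S a (Y : compactMetric R)
    (f : forall b, (b < a)%O -> S b -> Y) : Prop :=
  (forall b (ba : (b < a)%O), nonexpansive (f b ba)) /\
  (forall b c (ba : (b < a)%O) (ca : (c < a)%O) (bc : (b <= c)%O) x,
     f c ca (ds_proj S bc x) = f b ba x).

(* Colimit, in the category of compact metric spaces and non-expansive
   mappings, of the restriction of [S] to the indices below [a]. *)
Definition is_inductive_limit S a (Y : compactMetric R)
    (f : forall b, (b < a)%O -> S b -> Y) : Prop :=
  is_cocone f /\
  forall (Z : compactMetric R) (g : forall b, (b < a)%O -> S b -> Z),
    is_cocone g ->
    exists! h : Y -> Z, nonexpansive h /\
      forall b (ba : (b < a)%O) x, h (f b ba x) = g b ba x.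

Definition is_bottom a : Prop := forall b, (a <= b)%O.

Definition is_successor a a' : Prop :=
  (a < a')%O /\ forall c, (a < c)%O -> (a' <= c)%O.

Definition is_limit a : Prop :=
  (exists b, (b < a)%O) /\
  forall b, (b < a)%O -> exists c, (b < c)%O /\ (c < a)%O.

(* [S a] is the iterated iso-derivative [X^(a)] and [ds_proj] the canonical
   projections, for all ordinals [a] in [W]. As inductive limits are only
   defined up to isometry, so is [S]. *)
Definition iso_derivatives (X : compactMetric R) S : Prop :=
  [/\ forall z, is_bottom z -> exists f : X -> S z, is_isometry f,
      forall a a' (aa' : (a <= a')%O), is_successor a a' ->
        is_iso_derivative (ds_proj S aa') &
      forall a, is_limit a ->
        is_inductive_limit (fun b (ba : (b < a)%O) => ds_proj S (ltW ba))].

Definition countable_ordinal a : Prop := countable [set b | (b < a)%O].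

End Transfinite.
End IsoDerivative.

Arguments directSystem R {d} W.
Arguments ds_proj {R d W} S {b c} bc x : rename.

(* The sequence of iso-derivatives exists along every well-ordered type: it is
   realised below by the metric quotients of a decreasing family of
   pseudometrics on [X]. *)
Module Existence.
Local Open Scope quotient_scope.

Section MetricQuotient.
Context {R : realType} (T : choiceType).

Record pmet := Pmet { pmet_fun :> T -> T -> R; pmetP : pseudometric pmet_fun }.

Variable rho : pmet.

Lemma pmxx x : rho x x = 0. Proof. by have [] := pmetP rho. Qed.
Lemma pmC x y : rho x y = rho y x. Proof. by have [] := pmetP rho. Qed.
Lemma pm_triangle y x z : rho x z <= rho x y + rho y z.
Proof. by have [] := pmetP rho. Qed.
Lemma pm_ge0 x y : 0 <= rho x y.
Proof.
by rewrite -(@pmulrn_lge0 _ _ 2)// mulr2n {2}(pmC x) -(pmxx x) pm_triangle.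
Qed.

Let E (x y : T) := rho x y == 0.
Let Exx : reflexive E. Proof. by move=> x; rewrite /E pmxx. Qed.
Let EC : symmetric E. Proof. by move=> x y; rewrite /E pmC. Qed.
Let Etr : transitive E.
Proof.
move=> y x z /eqP xy /eqP yz; rewrite /E eq_le pm_ge0 andbT.
by rewrite (le_trans (pm_triangle y x z))// xy yz addr0.
Qed.

Canonical pm_equiv := EquivRel E Exx EC Etr.

Definition pquot : Type := {eq_quot pm_equiv}.
HB.instance Definition _ := Choice.on pquot.
Definition pclass (x : T) : pquot := \pi_({eq_quot pm_equiv}) x.
Definition prepr (u : pquot) : T := repr (u : {eq_quot pm_equiv}).

Lemma preprK u : pclass (prepr u) = u.
Proof. exact: reprK. Qed.
Lemma pclassP x y : pclass x = pclass y <-> rho x y = 0.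
Proof. by split => [/eqmodP/eqP|xy]//; apply/eqmodP/eqP. Qed.
Lemma prepr_class x : rho (prepr (pclass x)) x = 0.
Proof. by apply/pclassP; rewrite preprK. Qed.

Let qd (u v : pquot) : R := rho (prepr u) (prepr v).
Let qdxx u : qd u u = 0. Proof. exact: pmxx. Qed.
Let qd_eq0 u v : qd u v = 0 -> u = v.
Proof. by move/pclassP; rewrite !preprK. Qed.
Let qdC u v : qd u v = qd v u. Proof. exact: pmC. Qed.
Let qd_tri v u w : qd u w <= qd u v + qd v w. Proof. exact: pm_triangle. Qed.

HB.instance Definition _ := @isMetric.Build R pquot qd qdxx qd_eq0 qdC qd_tri.

Lemma pclass_dist x y : mdist (pclass x) (pclass y) = rho x y.
Proof.
have h a a' b : rho a a' = 0 -> rho a b <= rho a' b.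
  by move=> aa'; rewrite (le_trans (pm_triangle a' _ _))// aa' add0r.
have h2 a a' b : rho a a' = 0 -> rho a b = rho a' b.
  by move=> aa'; apply/eqP; rewrite eq_le !h// pmC.
rewrite -[LHS]/(rho _ _) (h2 _ x) ?prepr_class// pmC (h2 _ y) ?prepr_class//.
exact: pmC.
Qed.
End MetricQuotient.

Arguments pmet : clear implicits.

Section Compactness.
Context {R : realType}.
Implicit Types (X Y : metricType R).

Lemma nonexp_continuous X Y (f : X -> Y) : nonexpansive f -> continuous f.
Proof.
move=> fN x A /nbhs_ballP[e /= e0 eA]; apply/nbhs_ballP; exists e => //= y.
rewrite ballEmdist /= => xy; apply: eA; rewrite ballEmdist/=.
exact: le_lt_trans (fN _ _) xy.
Qed.

Lemma nonexp_compact X Y (f : X -> Y) : nonexpansive f ->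
  (forall y, exists x, f x = y) -> compact [set: X] -> compact [set: Y].
Proof.
move=> fN fs cX; have -> : [set: Y] = f @` [set: X].
  by apply/seteqP; split => // y _; have [x <-] := fs y; exists x.
apply: continuous_compact => //; apply: continuous_subspaceT.
exact: nonexp_continuous.
Qed.

Lemma isometry_id X : is_isometry (@id X).
Proof. by split => // y; exists y. Qed.

Lemma isometry_comp X Y (Z : metricType R) (g : Y -> Z) (f : X -> Y) :
  is_isometry g -> is_isometry f -> is_isometry (g \o f).
Proof.
move=> [gi gs] [fi fs]; split=> [x y|z]; first by rewrite /= gi fi.
by have [y <-] := gs z; have [x <-] := fs y; exists x.
Qed.

Lemma isometry_inv X Y (f : X -> Y) : is_isometry f ->
  exists g : Y -> X, [/\ is_isometry g, cancel f g & cancel g f].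
Proof.
move=> [fi /choice[g gK]].
have fK : cancel f g.
  by move=> x; apply: mdist_positivity; rewrite -fi gK mdistxx.
exists g; split => //; split; last by move=> x; exists (f x).
by move=> x y; rewrite -fi !gK.
Qed.

Lemma iso_equiv_refl X (x : X) : iso_equiv x x.
Proof. by exists id; split => //; exact: isometry_id. Qed.

(* Distance between orbits. *)
Definition orb_set X (x y : X) :=
  [set r | exists phi : X -> X, is_isometry phi /\ r = mdist x (phi y)].
Definition orb_dist X (x y : X) : R := inf (orb_set x y).

Lemma orb_le X (x y : X) phi : is_isometry phi -> orb_dist x y <= mdist x (phi y).
Proof.
move=> hp; apply: ge_inf; last by exists phi.
by exists 0 => _ [? [_ ->]]; exact: mdist_ge0.
Qed.

Lemma orb_ge X (x y : X) r :
  (forall phi, is_isometry phi -> r <= mdist x (phi y)) -> r <= orb_dist x y.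
Proof.
move=> h; apply: lb_le_inf; last by move=> _ [phi [? ->]]; exact: h.
by exists (mdist x y), id; split => //; exact: isometry_id.
Qed.

Lemma orb_pm X : pseudometric (@orb_dist X).
Proof.
split=> [x|x y|x y z].
- apply/eqP; rewrite eq_le; apply/andP; split.
    by rewrite (le_trans (orb_le _ _ (isometry_id X)))// mdistxx.
  by apply: orb_ge => phi _; exact: mdist_ge0.
- suff h (u v : X) : orb_dist u v <= orb_dist v u by apply/eqP; rewrite eq_le !h.
  apply: orb_ge => phi hp; have [g [gi fK gK]] := isometry_inv hp.
  by rewrite (le_trans (orb_le _ _ gi))// -(proj1 hp) gK metric_sym.
- rewrite -lerBlDr; apply: orb_ge => phi hp; rewrite lerBlDr addrC -lerBlDr.
  apply: orb_ge => psi hs. rewrite lerBlDr addrC.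
  rewrite (le_trans (orb_le _ _ (isometry_comp hp hs)))//=.
  by rewrite (le_trans (metric_triangle _ (phi y) _))// (proj1 hp).
Qed.

Lemma ultra_lim X (T : Type) (U : set_system T) : UltraFilter U ->
  compact [set: X] -> forall f : T -> X,
  exists p, forall e, 0 < e -> U [set t | mdist p (f t) < e].
Proof.
move=> UU cX f; have := cX (f @ U) _ filterT.
case=> p [_]; rewrite clusterE => clp; exists p => e e0.
have [//|nU] := in_ultra_setVsetC [set t | mdist p (f t) < e] UU.
have := clp (~` [set y | mdist p y < e]) nU.
move=> /(_ (ball p e) (nbhsx_ballx _ _ e0)) [y [/=]].
by rewrite ballEmdist.
Qed.

Lemma orb_eq0 X (x y : X) : compact [set: X] -> orb_dist x y = 0 ->
  iso_equiv y x.
Proof.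
move=> cX xy0.
pose B e := [set phi : X -> X | is_isometry phi /\ mdist x (phi y) < e].
have B0 e : 0 < e -> B e !=set0.
  move=> e0; apply: contrapT => Be.
  have : e <= orb_dist x y.
    apply: orb_ge => phi hp; rewrite leNgt; apply/negP => lte.
    by apply: Be; exists phi.
  by rewrite xy0 leNgt e0.
have FF : ProperFilter (filter_from [set e : R | 0 < e] B).
  apply: filter_from_proper => [|e /B0//]; apply: filter_from_filter.
    by exists 1 => /=.
  move=> e1 e2 /= e10 e20; exists (Num.min e1 e2); first by rewrite lt_min e10.
  by move=> phi [hp]; rewrite lt_min => /andP[? ?]; split; split.
have [U [UU FU]] := ultraFilterLemma FF.
have Uiso : U [set phi | is_isometry phi].
  by apply: FU; exists 1 => //= phi [].
have Uxy e : 0 < e -> U [set phi | mdist x (phi y) < e].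
  by move=> e0; apply: FU; exists e => //= phi [].
have [inv invP] : exists inv : (X -> X) -> (X -> X), forall phi, is_isometry phi ->
    [/\ is_isometry (inv phi), cancel phi (inv phi) & cancel (inv phi) phi].
  suff /choice[h hP] : forall phi : X -> X, exists g : X -> X, is_isometry phi ->
    [/\ is_isometry g, cancel phi g & cancel g phi] by exists h.
  move=> phi; have [hp|np] := pselect (is_isometry phi); last by exists id.
  by have [g gP] := isometry_inv hp; exists g.
have [psi psiP] := choice (fun z => ultra_lim UU cX (fun phi => phi z)).
have [chi chiP] := choice (fun z => ultra_lim UU cX (fun phi => inv phi z)).
have small (a : R) : (forall e, 0 < e -> a <= e) -> a <= 0.
  by move=> h; apply/ler_addgt0Pl => e e0; rewrite addr0 h.
have eqd (u v : X) : (forall e, 0 < e -> mdist u v <= e) -> u = v.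
  by move=> h; apply: mdist_positivity; apply/eqP; rewrite eq_le; apply/andP; split;
    [exact: small|exact: mdist_ge0].
have psi_iso u v : mdist (psi u) (psi v) = mdist u v.
  apply/eqP; rewrite eq_le; apply/andP; split; apply/ler_addgt0Pl => e e0;
    have e20 : 0 < e / 2 by rewrite divr_gt0.
  - have [phi [[hp hu] hv]] :=
      filter_ex (filterI (filterI Uiso (psiP u _ e20)) (psiP v _ e20)).
    rewrite (le_trans (metric_triangle _ (phi u) _))// [e]splitr -addrA lerD//.
      exact: ltW.
    rewrite (le_trans (metric_triangle _ (phi v) _))// (proj1 hp) addrC lerD//.
    by rewrite metric_sym ltW.
  - have [phi [[hp hu] hv]] :=
      filter_ex (filterI (filterI Uiso (psiP u _ e20)) (psiP v _ e20)).
    rewrite -(proj1 hp).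
    rewrite (le_trans (metric_triangle _ (psi u) _))// [e]splitr -addrA lerD//.
      by rewrite metric_sym ltW.
    rewrite (le_trans (metric_triangle _ (psi v) _))// addrC lerD//.
    exact: ltW.
exists psi; split; last first.
  apply: eqd => e e0; have e20 : 0 < e / 2 by rewrite divr_gt0.
  have [phi [hp hy]] := filter_ex (filterI (psiP y _ e20) (Uxy _ e20)).
  rewrite (le_trans (metric_triangle _ (phi y) _))// [e]splitr lerD// ?(ltW hp)//.
  by rewrite metric_sym ltW.
split => // z; exists (chi z).
apply: eqd => e e0; have e20 : 0 < e / 2 by rewrite divr_gt0.
have [phi [[hp h1] h2]] :=
  filter_ex (filterI (filterI Uiso (psiP (chi z) _ e20)) (chiP z _ e20)).
rewrite (le_trans (metric_triangle _ (phi (chi z)) _))// [e]splitr lerD// ?(ltW h1)//.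
have [gi fK gK] := invP _ hp.
by rewrite -{2}(gK z) (proj1 hp) ltW.
Qed.

Lemma iso_equiv_orb X (x y : X) : iso_equiv y x -> orb_dist x y = 0.
Proof.
move=> [phi [hp <-]]; apply/eqP; rewrite eq_le; apply/andP; split.
  by rewrite (le_trans (orb_le _ _ hp))// mdistxx.
by apply: orb_ge => psi _; exact: mdist_ge0.
Qed.

End Compactness.

Section Existence.
Context {R : realType} (X : compactMetric R).
Context {d : Order.disp_t} {W : orderType d}.
Hypothesis Wwo : well_order (<=%O : rel W).

Local Notation wlt := (fun b a : W => (b < a)%O).

Lemma wo_wf : well_founded wlt.
Proof.
move=> a; apply: contrapT => na.
have [z [[]]] : exists! z, minimum_of (<=%O : rel W)
    (fun b => `[< ~ Acc wlt b >]) z.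
  by apply: Wwo; exists a; rewrite unfold_in; exact/asboolP.
rewrite unfold_in => /asboolP nz zmin _; apply: nz; constructor => b bz.
apply: contrapT => nb; have := zmin b; rewrite unfold_in leNgt bz => /(_ _)/negP.
by apply => //; exact/asboolP.
Qed.

Lemma zero_pmP : pseudometric (fun _ _ : X => 0 : R).
Proof. by split => // x y z; rewrite addr0. Qed.

Definition to_pm (f : X -> X -> R) : pmet R X :=
  if pselect (pseudometric f) is left fP then Pmet fP else Pmet zero_pmP.

Lemma to_pmE f : pseudometric f -> to_pm f = f :> (X -> X -> R).
Proof. by rewrite /to_pm; case: pselect. Qed.

Definition step (rho : pmet R X) (x y : X) : R :=
  orb_dist (pclass rho x) (pclass rho y).

Definition cands a (rec : forall b, wlt b a -> X -> X -> R) :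
    set (X -> X -> R) :=
  [set f | f = (@mdist R X) \/
           exists b (ba : wlt b a), f = step (to_pm (rec b ba))].

(* The pseudometric on [X] whose metric quotient is [X^(a)]. *)
Definition iter_dist : W -> X -> X -> R :=
  Fix wo_wf (fun _ => X -> X -> R)
    (fun a rec x y => inf [set f x y | f in cands rec]).

Definition iter_pm a : pmet R X := to_pm (iter_dist a).

Definition iter_cands a : set (X -> X -> R) :=
  [set f | f = (@mdist R X) \/
           exists b, (b < a)%O /\ f = step (iter_pm b)].

Lemma iter_distE a x y : iter_dist a x y = inf [set f x y | f in iter_cands a].
Proof.
rewrite /iter_dist Fix_eq => [|b f g fg]; last first.
  suff -> : f = g by [].
  by apply: functional_extensionality_dep => c; apply/funext => bc; exact: fg.
congr (inf [set f x y | f in _]); apply/seteqP; split => f /= [->|]; try by left.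
  by move=> [b [ba ->]]; right; exists b; split.
by move=> [b [ba ->]]; right; exists b, ba.
Qed.

Lemma step_pm rho : pseudometric (step rho).
Proof.
have [h1 h2 h3] := orb_pm (pquot rho).
by split => *; [exact: h1|exact: h2|exact: h3].
Qed.

Lemma step_le (rho : pmet R X) x y : step rho x y <= rho x y.
Proof.
by rewrite -pclass_dist; exact: (orb_le _ _ (isometry_id (pquot rho))).
Qed.

Lemma mdist_pm : pseudometric (@mdist R X).
Proof.
split; [exact: mdistxx|exact: metric_sym|].
by move=> x y z; exact: metric_triangle.
Qed.

Lemma pseudometric_ge0 T (f : T -> T -> R) x y : pseudometric f -> 0 <= f x y.
Proof.
move=> [f0 fC ft].
by rewrite -(@pmulrn_lge0 _ _ 2)// mulr2n {2}fC -(f0 x) ft.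
Qed.

Lemma iter_cands_pm a f : iter_cands a f -> pseudometric f.
Proof. by move=> [->|[b [_ ->]]]; [exact: mdist_pm|exact: step_pm]. Qed.

Lemma iter_dist_le a f x y : iter_cands a f -> iter_dist a x y <= f x y.
Proof.
move=> fa; rewrite iter_distE; apply: ge_inf; last by exists f.
by exists 0 => _ [g /iter_cands_pm gP <-]; exact: pseudometric_ge0.
Qed.

Lemma iter_dist_ge a x y r : (forall f, iter_cands a f -> r <= f x y) ->
  r <= iter_dist a x y.
Proof.
move=> h; rewrite iter_distE; apply: lb_le_inf => [|_ [f fa <-]]; last exact: h.
by exists (mdist x y), (@mdist R X) => //; left.
Qed.

Lemma iter_dist_pm a : pseudometric (iter_dist a).
Proof.
elim/(well_founded_ind wo_wf): a => a IH.
have D b : (b < a)%O -> iter_pm b = iter_dist b :> (X -> X -> R).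
  by move=> /IH/to_pmE.
have mono b f x y : (b < a)%O -> iter_cands b f -> step (iter_pm b) x y <= f x y.
  move=> ba fb; rewrite (le_trans (step_le _ _ _))// D//; exact: iter_dist_le.
have chainF f g : iter_cands a f -> iter_cands a g ->
    (forall x y, f x y <= g x y) \/ (forall x y, g x y <= f x y).
  move=> [->|[b [ba ->]]] [->|[c [ca ->]]].
  - by left.
  - by right => x y; apply: mono => //; left.
  - by left => x y; apply: mono => //; left.
  - have [bc|cb|<-] := ltgtP b c; last by left.
      by right => x y; apply: mono => //; right; exists b.
    by left => x y; apply: mono => //; right; exists c.
have idle f : iter_cands a f -> pseudometric f by exact: iter_cands_pm.
split=> [x|x y|x y z].
- apply/eqP; rewrite eq_le; apply/andP; split.
    by rewrite (le_trans (iter_dist_le (f := mdist) _ _ _))//; [left|rewrite mdistxx].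
  by apply: iter_dist_ge => f /idle fP; exact: pseudometric_ge0.
- suff h (u v : X) : iter_dist a u v <= iter_dist a v u.
    by apply/eqP; rewrite eq_le !h.
  apply: iter_dist_ge => f fa; have [_ fC _] := idle _ fa.
  by rewrite fC; exact: iter_dist_le.
- rewrite -lerBlDr; apply: iter_dist_ge => f fa; rewrite lerBlDr addrC -lerBlDr.
  apply: iter_dist_ge => g ga; rewrite lerBlDr addrC.
  have [_ _ ft] := idle _ fa; have [_ _ gt] := idle _ ga.
  have [fg|gf] := chainF _ _ fa ga.
    rewrite (le_trans (iter_dist_le _ _ fa))// (le_trans (ft _ y _))//.
    by rewrite lerD.
  rewrite (le_trans (iter_dist_le _ _ ga))// (le_trans (gt _ y _))//.
  by rewrite lerD.
Qed.

Lemma iter_pmE a : iter_pm a = iter_dist a :> (X -> X -> R).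
Proof. exact/to_pmE/iter_dist_pm. Qed.

Lemma iter_dist_step a b x y : (b < a)%O ->
  iter_dist a x y <= step (iter_pm b) x y.
Proof. by move=> ba; apply: iter_dist_le; right; exists b. Qed.

Lemma iter_pm_le a b x y : (a <= b)%O -> iter_pm b x y <= iter_pm a x y.
Proof.
rewrite le_eqVlt => /predU1P[->//|ab]; rewrite (iter_pmE b).
exact: le_trans (iter_dist_step _ _ ab) (step_le _ _ _).
Qed.

Lemma iter_compact a : compact [set: pquot (iter_pm a)].
Proof.
apply: (@nonexp_compact R X _ (pclass (iter_pm a))) => [x y|u|].
- by rewrite pclass_dist iter_pmE; apply: iter_dist_le; left.
- by exists (prepr u); exact: preprK.
- exact: cm_compact.
Qed.

Definition iter_space a : compactMetric R := CompactMetric (@iter_compact a).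

Definition iter_proj b c (bc : (b <= c)%O) (u : iter_space b) : iter_space c :=
  pclass (iter_pm c) (prepr u).

Lemma iter_projE b c (bc : (b <= c)%O) x :
  iter_proj bc (pclass (iter_pm b) x) = pclass (iter_pm c) x.
Proof.
apply/pclassP; apply/eqP; rewrite eq_le pm_ge0 andbT.
by rewrite (le_trans (iter_pm_le _ _ bc))// prepr_class.
Qed.

Lemma iter_proj_nonexp b c (bc : (b <= c)%O) : nonexpansive (iter_proj bc).
Proof.
move=> u v; rewrite -(preprK u) -(preprK v) !iter_projE !pclass_dist.
exact: iter_pm_le.
Qed.

Lemma iter_proj_id b (bb : (b <= b)%O) u : iter_proj bb u = u.
Proof. by rewrite -(preprK u) iter_projE. Qed.

Lemma iter_proj_comp a b c (ab : (a <= b)%O) (bc : (b <= c)%O)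
  (ac : (a <= c)%O) u : iter_proj bc (iter_proj ab u) = iter_proj ac u.
Proof. by rewrite -(preprK u) !iter_projE. Qed.

Definition iter_system : directSystem R W :=
  DirectSystem iter_proj_nonexp iter_proj_id iter_proj_comp.

Lemma iter_derivatives : iso_derivatives X iter_system.
Proof.
split.
- move=> z zbot; exists (pclass (iter_pm z)).
  split=> [x y|u]; last by exists (prepr u); exact: preprK.
  apply/eqP; rewrite [mdist _ _]pclass_dist iter_pmE eq_le; apply/andP; split.
    by apply: iter_dist_le; left.
  apply: iter_dist_ge => f [->//|[b [bz _]]].
  by have := zbot b; rewrite leNgt bz.
- move=> a a' aa' [lta sa].
  have DE x y : iter_pm a' x y = step (iter_pm a) x y.
    apply/eqP; rewrite iter_pmE eq_le; apply/andP; split.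
      exact: iter_dist_step.
    apply: iter_dist_ge => f [->|[b [ba ->]]].
      rewrite (le_trans (step_le _ _ _))// iter_pmE.
      by apply: iter_dist_le; left.
    have : (b <= a)%O by rewrite leNgt; apply/negP => /sa; rewrite leNgt ba.
    rewrite le_eqVlt => /predU1P[->//|ltb].
    rewrite (le_trans (step_le _ _ _))// iter_pmE; exact: iter_dist_step.
  have ker (u v : pquot (iter_pm a)) :
      iter_proj aa' u = iter_proj aa' v <-> iso_equiv u v.
    rewrite -(preprK u) -(preprK v) !iter_projE pclassP DE /step.
    set x := pclass _ _; set y := pclass _ _.
    have [_ oC _] := orb_pm (pquot (iter_pm a)); rewrite oC; split.
      apply: orb_eq0; exact: iter_compact.
    exact: iso_equiv_orb.
  split => //=.
  + by move=> u; exists (pclass (iter_pm a) (prepr u)); rewrite iter_projE preprK.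
  + exact: iter_proj_nonexp.
  move=> rho rhoP rho_le u v.
  rewrite -(preprK u) -(preprK v) pclass_dist DE /step.
  rewrite -!(iter_projE aa').
  apply: orb_ge => phi hp; set x := pclass _ _; set y := pclass _ _.
  have -> : iter_proj aa' y = iter_proj aa' (phi y) by apply/ker; exists phi.
  exact: rho_le.
- move=> a [[b0 b0a] lim]; split.
    split=> [b ba|b c ba ca bc x]; first exact: iter_proj_nonexp.
    exact: iter_proj_comp.
  move=> Z g [gN gC].
  have gE b (ba : (b < a)%O) x : g b ba (pclass (iter_pm b) x) =
      g b0 b0a (pclass (iter_pm b0) x).
    have [bb|/ltW bb] := leP b b0.
      by rewrite -(gC _ _ ba b0a bb) /= iter_projE.
    by rewrite -(gC _ _ b0a ba bb) /= iter_projE.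
  have aE x y r : (forall b, (b < a)%O -> r <= iter_pm b x y) -> r <= iter_pm a x y.
    move=> h; rewrite iter_pmE; apply: iter_dist_ge => f [->|[b [ba ->]]].
      by rewrite (le_trans (h _ b0a))// iter_pmE; apply: iter_dist_le; left.
    have [c [bc ca]] := lim _ ba.
    by rewrite (le_trans (h _ ca))// iter_pmE; exact: iter_dist_step.
  pose h (u : iter_system a) : Z := g b0 b0a (pclass (iter_pm b0) (prepr u)).
  have hE x : h (pclass (iter_pm a) x) = g b0 b0a (pclass (iter_pm b0) x).
    apply: mdist_positivity; apply/eqP; rewrite eq_le mdist_ge0 andbT.
    rewrite -(prepr_class (iter_pm a) x); apply: aE => b ba.
    by rewrite /h -!(gE _ ba) -pclass_dist; exact: gN.
  exists h; split; first split.
  + move=> u v; rewrite -(preprK u) -(preprK v) !hE pclass_dist.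
    by apply: aE => b ba; rewrite -!(gE _ ba) -pclass_dist; exact: gN.
  + move=> b ba u; rewrite -(preprK u) [ds_proj _ _ _]iter_projE hE.
    by rewrite -(gE _ ba).
  move=> h' [_ h'E]; apply/funext => u; rewrite -(preprK u) hE.
  by rewrite -(h'E _ b0a) /= iter_projE.
Qed.

End Existence.

Section UncountableWellOrder.

Lemma set_nat_uncountable : ~ countable [set: set nat].
Proof.
move=> /countable_injP[f finj].
pose D : set nat := [set n | exists A, f A = n /\ ~ A n].
have [Df|nDf] := pselect (D (f D)).
  have [A [fA nA]] := Df; apply: nA.
  by rewrite (finj A D) ?inE// -fA.
by apply: (nDf); exists D.
Qed.

Definition le_sn : rel (set nat) := sval (@well_ordering_principle (set nat)).
Definition le_snP : well_order le_sn := svalP (@well_ordering_principle (set nat)).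

Definition wo_set_nat : Type := set nat.
HB.instance Definition _ := Choice.on wo_set_nat.

Let le_sn_chain : wo_chain le_sn predT.
Proof. by move=> A _; exact: le_snP. Qed.
Let le_sn_anti : antisymmetric le_sn.
Proof. by move=> x y; exact: (wo_chain_antisymmetric le_sn_chain). Qed.
Let le_sn_total : total le_sn.
Proof. by move=> x y; exact: (wo_chainW le_sn_chain). Qed.
Let le_sn_trans : transitive le_sn.
Proof.
move=> y x z xy yz.
have [m [[]]] := le_snP (ex_intro (fun t => t \in pred3 x y z) x (predU1l _ erefl)).
move=> mE mlb _.
have mx : le_sn m x by apply: mlb; rewrite inE eqxx.
have my : le_sn m y by apply: mlb; rewrite !inE eqxx orbT.
have mz : le_sn m z by apply: mlb; rewrite !inE eqxx !orbT.
move: mE mx my mz; rewrite !inE => /or3P[] /eqP-> // a b c.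
- by rewrite (@le_sn_anti x y) ?xy// a.
- by rewrite -(@le_sn_anti y z) ?yz ?b.
Qed.

Let le_sn_refl : reflexive le_sn.
Proof. by move=> x; exact: (wo_chain_reflexive le_sn_chain). Qed.

HB.instance Definition _ := @Order.Le_isPOrder.Build (Order.Disp tt tt)
  wo_set_nat le_sn le_sn_refl le_sn_anti le_sn_trans.
HB.instance Definition _ := @Order.POrder_isTotal.Build (Order.Disp tt tt)
  wo_set_nat le_sn_total.

End UncountableWellOrder.

Lemma iso_derivatives_exist (R : realType) (X : compactMetric R)
    (d : Order.disp_t) (W : orderType d) :
  well_order (<=%O : rel W) ->
  exists S : directSystem R W, iso_derivatives X S.
Proof. by move=> Wwo; exists (iter_system X Wwo); exact: iter_derivatives. Qed.

Lemma uncountable_well_order_exists :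
  exists (d : Order.disp_t) (W : orderType d),
    well_order (<=%O : rel W) /\ ~ countable [set: W].
Proof.
exists (Order.Disp tt tt), wo_set_nat; split; first exact: le_snP.
exact: set_nat_uncountable.
Qed.

End Existence.

(* Main.v *)
Require Import Defs.
From HB Require Import structures.
From mathcomp Require Import all_boot all_order all_algebra.
From mathcomp Require Import all_classical all_reals topology wochoice.
From mathcomp Require Import lra.
Set Implicit Arguments.
Unset Strict Implicit.
Unset Printing Implicit Defensive.
Local Open Scope classical_set_scope.

Import Order.TTheory GRing.Theory Num.Theory.
Local Open Scope ring_scope.

(** Pull the metrics of all the spaces [S a] back to the bottom space [S z]
    along the projections. This gives pseudometrics [rho a] on one compact
    metric space, pointwise decreasing in [a] because projections are
    non-expansive, and each at most the metric. Suppose that no countable [a]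
    has an isometric projection to its successor [a']. Then [rho a' < rho a]
    at some pair of points and, by continuity, at some pair [(s, t)] from a
    fixed countable dense set; pick a rational [q] strictly between
    [rho a' s t] and [rho a s t]. By monotonicity a triple [(s, t, q)] serves
    at most one [a], so there are countably many countable ordinals, which is
    absurd along an uncountable well-order
    ([strictly_decreasing_pseudometrics_countable],
    [uncountable_countable_ordinals]).

    Comparing metrics on [S z] only sees the images of the projections from
    [S z], so these must be onto. At successors this is part of the
    definition. At a limit [c], the image of [S z] receives a cocone, so the
    universal property retracts [S c] into the image, and by uniqueness that
    retraction is the identity ([limit_proj_surjective]).

    Once a projection [S a -> S a'] is isometric, hence injective, distinct
    points of [S a] lie in distinct orbits. This property is invariant under
    isometry and makes every iso-derivative isometric, which propagates the
    isometry through successors. At a limit the inverses of the earlier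
    projections form a cocone over [S a], and the induced map inverts the
    projection from [S a] ([stationary_proj_isometry]). Cancelling the
    projection from [S a] to [S b] gives the isometry from [S b] to [S c]. *)

(** * Metric spaces, orbits and iso-derivatives *)

Section MetricSpaces.
(* Makes the metric structure on [Existence.pquot] available to inference. *)
Import (canonicals) Existence.
Context {R : realType}.
Implicit Types X Y Z : metricType R.

Lemma nonexpansive_comp X Y Z (g : Y -> Z) (f : X -> Y) :
  nonexpansive g -> nonexpansive f -> nonexpansive (g \o f).
Proof. by move=> gN fN x y; exact: le_trans (gN _ _) (fN _ _). Qed.

Lemma isometry_inj X Y (f : X -> Y) : is_isometry f -> injective f.
Proof.
by move=> [fi _] x y fxy; apply: mdist_positivity; rewrite -fi fxy mdistxx.
Qed.

Lemma isometry_comp_cancelr X Y Z (g : Y -> Z) (f : X -> Y) :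
  is_isometry f -> is_isometry (g \o f) -> is_isometry g.
Proof.
move=> [fi fs] [gfi gfs]; split=> [y y'|w].
  have [x <-] := fs y; have [x' <-] := fs y'.
  by rewrite -[LHS]/(mdist ((g \o f) x) ((g \o f) x')) gfi fi.
by have [x <-] := gfs w; exists (f x).
Qed.

Lemma pseudometric_pullback T X (f : T -> X) :
  pseudometric (fun x y => mdist (f x) (f y)).
Proof.
split=> *; [exact: mdistxx|exact: metric_sym|exact: metric_triangle].
Qed.

Definition trivial_orbits X : Prop := forall x y : X, iso_equiv x y -> x = y.

Lemma trivial_orbits_isometry X Y (f : X -> Y) : is_isometry f ->
  trivial_orbits X -> trivial_orbits Y.
Proof.
move=> fi tX y y' [phi [phii <-]].
have [g [gi fK gK]] := Existence.isometry_inv fi.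
apply: (isometry_inj gi); apply: tX; exists (g \o (phi \o f)); split.
  exact: Existence.isometry_comp gi (Existence.isometry_comp phii fi).
by rewrite /= gK.
Qed.

Lemma iso_derivative_trivial_orbits X Y (p : X -> Y) :
  is_iso_derivative p -> is_isometry p -> trivial_orbits X.
Proof. by move=> [_ pE _ _] pi x y /pE/(isometry_inj pi). Qed.

(** Since [p] is then a bijection, the metric of [X] can be transported to
    [Y]; it competes in the maximality of the metric of [Y]. *)
Lemma iso_derivative_isometry X Y (p : X -> Y) :
  is_iso_derivative p -> trivial_orbits X -> is_isometry p.
Proof.
move=> [ps pE pN pmax] tX; have [g gK] := choice ps.
have pK : cancel p g by move=> x; apply/tX/pE; rewrite gK.
split=> // x x'; apply: le_anti; rewrite pN /=.
have := pmax _ (pseudometric_pullback g) _ (p x) (p x').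
by rewrite !pK; apply=> u v; rewrite !pK.
Qed.

Lemma compact_countable_dense X : compact [set: X] ->
  exists2 Q : set X, countable Q &
    forall x e, 0 < e -> exists2 q, Q q & mdist x q < e.
Proof.
move=> cX; have [[x0 _]|X0] := pselect (exists x : X, True); last first.
  by exists set0 => // x; case: X0; exists x.
(* Second countability is stated for pointed spaces. *)
pose T : pseudoPMetricType R := HB.pack (Metric.sort X) (isPointed.Build _ x0).
have [B cB [_ Bb]] : @second_countable T := @compact_second_countable R T cX.
exists [set xget x0 V | V in B].
  by apply: sub_countable cB; exact: card_image_le.
move=> x e e0; have [V [BV Vx] Ve] := Bb x _ (nbhsx_ballx (x : T) _ e0).
exists (xget x0 V); first by exists V.
have /Ve : V (xget x0 V) by apply: xgetPex; exists x; exact: Vx.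
by rewrite [ball _ _](@ballEmdist R X).
Qed.

(** Both pseudometrics are continuous, so a strict inequality between them
    persists near [(x, y)]. *)
Lemma pseudometric_gap_dense X (Q : set X) (rho sigma : X -> X -> R) :
  (forall x e, 0 < e -> exists2 q, Q q & mdist x q < e) ->
  pseudometric rho -> (forall x y, rho x y <= mdist x y) ->
  pseudometric sigma -> (forall x y, sigma x y <= mdist x y) ->
  forall x y, sigma x y < rho x y ->
  exists s t, [/\ Q s, Q t & sigma s t < rho s t].
Proof.
move=> Qd [_ rC rt] rN [_ sC st] sN x y sr.
(* Moving the two points by less than [e] costs less than [2 * e] for each of
   [rho] and [sigma]. *)
pose e := (rho x y - sigma x y) / 4.
have e0 : 0 < e by rewrite divr_gt0// subr_gt0.
have [s Qs xs] := Qd x _ e0; have [t Qt yt] := Qd y _ e0.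
exists s, t; split=> //.
have r1 := rt x s y; have r2 := rt s t y.
have s1 := st s x t; have s2 := st x y t.
have := rN x s; have := rN y t; have := sN x s; have := sN y t.
rewrite (rC y t) (sC x s) => *.
have ee : e + e + e + e = rho x y - sigma x y by rewrite /e; lra.
lra.
Qed.

(** The image of [p] as a space of its own. It is built as the metric quotient
    of [X] by the pulled back metric, which avoids a metric on a subtype of
    [Y]. *)
Lemma compact_image_factorization (X : compactMetric R) Y (p : X -> Y) :
  nonexpansive p ->
  exists (Q : compactMetric R) (q : X -> Q) (i : Q -> Y),
    [/\ forall u, exists x, q x = u,
        forall u v, mdist (i u) (i v) = mdist u v &
        forall x, i (q x) = p x].
Proof.
move=> pN; have rhoP := pseudometric_pullback p.
pose Q : metricType R := Existence.pquot (Existence.Pmet rhoP).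
pose q : X -> Q := Existence.pclass (Existence.Pmet rhoP).
have qs (u : Q) : exists x, q x = u.
  by exists (Existence.prepr u); exact: Existence.preprK.
have qN : nonexpansive q.
  by move=> x x'; rewrite Existence.pclass_dist; exact: pN.
pose i (u : Q) := p (Existence.prepr u).
exists (CompactMetric (Existence.nonexp_compact qN qs (@cm_compact _ X))), q, i.
split=> // x; apply: mdist_positivity.
exact: (Existence.prepr_class (Existence.Pmet rhoP) x).
Qed.

End MetricSpaces.

(** * Countable ordinals in a well-order *)

Section WellOrders.
Context {d : Order.disp_t} {W : orderType d}.
Implicit Types a b c : W.

Lemma bottom_successor_or_limit a :
  [\/ is_bottom a, exists b, is_successor b a | is_limit a].
Proof.
have [ab|nab] := pselect (is_bottom a); first by constructor 1.
have [[b ba]|nb] := pselect (exists b, is_successor b a).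
  by constructor 2; exists b.
constructor 3; split=> [|b ba].
  apply: contrapT => nlt; apply: nab => b.
  by rewrite leNgt; apply/negP => ba; apply: nlt; exists b.
apply: contrapT => nc; apply: nb; exists b; split=> // c bc.
by rewrite leNgt; apply/negP => ca; apply: nc; exists c.
Qed.

Hypothesis Wwo : well_order (<=%O : rel W).

Lemma well_order_min (A : set W) : A !=set0 ->
  exists2 m, A m & forall b, A b -> (m <= b)%O.
Proof.
move=> [a Aa]; have [|m [[Am mmin] _]] := Wwo (A := fun b => `[< A b >]).
  by exists a; rewrite unfold_in; exact/asboolP.
exists m; first by move: Am; rewrite unfold_in => /asboolP.
by move=> b Ab; apply: mmin; rewrite unfold_in; exact/asboolP.
Qed.

(** If some ordinal of [W] is uncountable, the least such one has exactly the
    countable ordinals below it. *)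
Lemma uncountable_countable_ordinals : ~ countable [set: W] ->
  ~ countable [set a : W | countable_ordinal a].
Proof.
move=> Wunc cC.
have [allC|/existsNP na] := pselect (forall a : W, countable_ordinal a).
  apply: Wunc; apply: sub_countable cC; apply: subset_card_le => a _.
  exact: allC.
have [m nm mmin] := @well_order_min [set a | ~ countable_ordinal a] na.
apply: nm; apply: sub_countable cC; apply: subset_card_le => b /= bm.
by apply: contrapT => /mmin; rewrite leNgt bm.
Qed.

(** A greatest element of [W] with countably many predecessors would make [W]
    countable. *)
Lemma countable_ordinal_successor : ~ countable [set: W] ->
  forall a, countable_ordinal a -> exists a', is_successor a a'.
Proof.
move=> Wunc a ca; have [|m am mmin] := @well_order_min [set b | (a < b)%O].
  apply: contrapT => nb; apply: Wunc.
  have -> : [set: W] =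
      \bigcup_(t in [set: bool]) (if t then [set b | (b < a)%O] else [set a]).
    apply/seteqP; split=> // b _; have [ba|ab|->] := ltgtP b a.
    - by exists true.
    - by case: nb; exists b.
    - by exists false.
  by apply: bigcup_countable => // -[] _ //; exact: countable1.
by exists m; split.
Qed.

(** Each drop at [a] in [C] crosses a rational at a pair of points of a
    countable dense set, and by monotonicity a given rational is crossed at a
    given pair at most once. *)
Lemma strictly_decreasing_pseudometrics_countable (R : realType) (X : metricType R)
    (C : set W) (rho : W -> X -> X -> R) :
  compact [set: X] ->
  (forall a, pseudometric (rho a)) ->
  (forall a x y, rho a x y <= mdist x y) ->
  (forall a b x y, (a <= b)%O -> rho b x y <= rho a x y) ->
  (forall a, C a -> exists a', is_successor a a' /\
     exists x y, rho a' x y < rho a x y) ->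
  countable C.
Proof.
move=> cX rhoP rhoN rhoD drop; have [Q cQ Qd] := compact_countable_dense cX.
pose F (k : X * X * rat) := [set a | C a /\ exists2 a', is_successor a a' &
  rho a' k.1.1 k.1.2 < ratr k.2 < rho a k.1.1 k.1.2].
have FC : countable (\bigcup_(k in Q `*` Q `*` [set: rat]) F k).
  apply: bigcup_countable => [|k _]; first by do 2?apply: countableX.
  apply/countable_injP; exists (fun=> 0%N) => a b.
  have ltF u v : F k u -> F k v -> ~ (u < v)%O.
    move=> [_ [u' [_ u'min] /andP[u'q _]]] [_ [_ _ /andP[_ qv]]] /u'min uv.
    have := lt_le_trans (lt_trans u'q qv) (rhoD _ _ _ _ uv).
    by rewrite ltxx.
  rewrite !inE => Fa Fb _.
  by have [/(ltF _ _ Fa Fb)|/(ltF _ _ Fb Fa)|] := ltgtP a b.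
apply: sub_countable FC; apply: subset_card_le => a Ca.
have [a' [aa' [x [y lt]]]] := drop _ Ca.
have [s [t [Qs Qt /rat_in_itvoo[q]]]] :=
  pseudometric_gap_dense Qd (rhoP a) (rhoN a) (rhoP a') (rhoN a') lt.
by rewrite in_itv/= => qst; exists (s, t, q) => //; split=> //; exists a'.
Qed.

End WellOrders.

(** * Projections of the transfinite sequence *)

Section Systems.
Context {R : realType} {d : Order.disp_t} {W : orderType d}.
Implicit Types (X : compactMetric R) (S : directSystem R W) (a b c : W).
Hypothesis Wwo : well_order (<=%O : rel W).

(** Uniqueness in the universal property, applied to the colimit cocone
    itself. *)
Lemma inductive_limit_endo_id S c (h : S c -> S c) :
  is_inductive_limit (fun b (bc : (b < c)%O) => ds_proj S (ltW bc)) ->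
  nonexpansive h ->
  (forall b (bc : (b < c)%O) x,
     h (ds_proj S (ltW bc) x) = ds_proj S (ltW bc) x) ->
  h =1 id.
Proof.
move=> [co univ] hN hE y; have [k [_ kuniq]] := univ _ _ co.
have kh : k = h by apply: kuniq.
have kid : k = id by apply: kuniq; split.
by rewrite -kh kid.
Qed.

(** The inverses of the projections from [S a] form a cocone with vertex [S a];
    the map [S c -> S a] that it induces is a two-sided non-expansive inverse
    of the projection. *)
Lemma limit_proj_isometry S a c (ac : (a <= c)%O) :
  (a < c)%O ->
  is_inductive_limit (fun b (bc : (b < c)%O) => ds_proj S (ltW bc)) ->
  (forall b (ab : (a <= b)%O), (b < c)%O -> is_isometry (ds_proj S ab)) ->
  is_isometry (ds_proj S ac).
Proof.
move=> ltac limS iso_ab.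
(* [y] is the image of [x] if [b <= a], and its preimage if [a <= b];
   comparing both points in a common [S e] treats the two cases at once. *)
have lift b (bc : (b < c)%O) (x : S b) : exists y : S a,
    forall e (ae : (a <= e)%O) (be : (b <= e)%O), (e < c)%O ->
      ds_proj S ae y = ds_proj S be x.
  have am : (a <= Order.max a b)%O by rewrite le_max lexx.
  have bm : (b <= Order.max a b)%O by rewrite le_max lexx orbT.
  have mc : (Order.max a b < c)%O by rewrite gt_max ltac.
  have [_ /(_ (ds_proj S bm x))[y yx]] := iso_ab _ am mc.
  exists y => e ae be _; have me : (Order.max a b <= e)%O by rewrite ge_max ae.
  by rewrite -(ds_proj_comp am me) yx ds_proj_comp.
pose g b bc x := sval (cid (@lift b bc x)).
have gE b bc x e (ae : (a <= e)%O) (be : (b <= e)%O) : (e < c)%O ->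
    ds_proj S ae (g b bc x) = ds_proj S be x.
  exact: (svalP (cid (@lift b bc x))).
have upper b : (b < c)%O -> exists e, [/\ (a <= e)%O, (b <= e)%O & (e < c)%O].
  move=> bc; exists (Order.max a b).
  by rewrite !le_max !lexx orbT gt_max ltac.
have [|h [[hN hE] _]] := (proj2 limS) (S a) g.
  split=> [b bc x x'|b b' bc b'c bb' x].
    have [e [ae be ec]] := upper b bc.
    rewrite -(proj1 (iso_ab e ae ec)) !(gE _ _ _ _ _ be)//.
    exact: ds_proj_nonexpansive.
  have [e [ae b'e ec]] := upper b' b'c; have be := le_trans bb' b'e.
  apply: (isometry_inj (iso_ab e ae ec)).
  by rewrite (gE _ _ _ _ _ b'e)// (gE _ _ _ _ _ be)// (ds_proj_comp _ _ be).
have hK : cancel (ds_proj S ac) h.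
  move=> y; rewrite (bool_irrelevance ac (ltW ltac)) hE.
  have := gE a ltac y a (lexx a) (lexx a) ltac.
  by rewrite !ds_proj_id.
split=> [y y'|w].
  apply: le_anti; rewrite ds_proj_nonexpansive /=.
  by rewrite -{1}(hK y) -{1}(hK y'); exact: hN.
exists (h w).
have hid : ds_proj S ac \o h =1 id; last exact: hid.
apply: inductive_limit_endo_id => //.
  exact: nonexpansive_comp (ds_proj_nonexpansive _) hN.
move=> b bc x /=; rewrite hE; have [e [ae be ec]] := upper b bc.
by rewrite -(ds_proj_comp ae (ltW ec)) (gE _ _ _ _ _ be)//; exact: ds_proj_comp.
Qed.

(** The image [Q] of [S z] in [S c] carries a cocone. Composing the induced map
    [S c -> Q] with the inclusion of [Q] gives an endomorphism of [S c] that
    fixes the projections, so the inclusion is onto. *)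
Lemma limit_proj_surjective S z c (zc : (z <= c)%O) :
  is_bottom z ->
  is_inductive_limit (fun b (bc : (b < c)%O) => ds_proj S (ltW bc)) ->
  (forall b (zb : (z <= b)%O), (b < c)%O ->
     forall y, exists x, ds_proj S zb x = y) ->
  forall y, exists x, ds_proj S zc x = y.
Proof.
move=> zbot limS surj_zb.
have [Q [q [i [qs iI iq]]]] :=
  compact_image_factorization (@ds_proj_nonexpansive _ _ _ S _ _ zc).
pose g b bc y : Q := q (sval (cid (@surj_zb b (zbot b) bc y))).
have ig b (bc : (b < c)%O) y : i (g b bc y) = ds_proj S (ltW bc) y.
  rewrite iq -(ds_proj_comp (zbot b) (ltW bc)).
  by rewrite (svalP (cid (@surj_zb b (zbot b) bc y))).
have [|h [[hN hE] _]] := (proj2 limS) Q g.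
  split=> [b bc x x'|b b' bc b'c bb' x].
    by rewrite -[leLHS]iI !ig; exact: ds_proj_nonexpansive.
  apply: mdist_positivity; rewrite -[LHS]iI !ig.
  by rewrite (ds_proj_comp _ _ (ltW bc)) mdistxx.
move=> y; have [x qx] := qs (h y); exists x; rewrite -iq qx.
have hid : i \o h =1 id; last exact: hid.
apply: inductive_limit_endo_id => //.
  by move=> u v; rewrite /= iI; exact: hN.
by move=> b bc u /=; rewrite hE; exact: ig.
Qed.

Lemma iso_derivatives_proj_surjective X S z : iso_derivatives X S ->
  is_bottom z -> forall a (za : (z <= a)%O) y, exists x, ds_proj S za x = y.
Proof.
move=> [_ succS limS] zbot.
elim/(well_founded_ind (Existence.wo_wf Wwo)) => a IH za.
have [abot|[b [ba bmin]]|la] := bottom_successor_or_limit a.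
- have az : a = z by apply: le_anti; rewrite abot zbot.
  by subst a => y; exists y; exact: ds_proj_id.
- move=> y; have [/(_ y)[w <-] _ _ _] := succS _ _ (ltW ba) (conj ba bmin).
  have [x <-] := IH b ba (zbot b) w.
  by exists x; rewrite ds_proj_comp.
- apply: limit_proj_surjective => //; first exact: limS.
  by move=> b zb ba; exact: IH.
Qed.

Lemma stationary_proj_isometry X S a : iso_derivatives X S ->
  trivial_orbits (S a) ->
  forall b (ab : (a <= b)%O), is_isometry (ds_proj S ab).
Proof.
move=> [_ succS limS] ta.
elim/(well_founded_ind (Existence.wo_wf Wwo)) => b IH ab.
have [eqab|ltab] : a = b \/ (a < b)%O.
  by move: ab; rewrite le_eqVlt => /predU1P.
  subst b; split=> [x y|y]; first by rewrite !ds_proj_id.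
  by exists y; exact: ds_proj_id.
have [bbot|[e [eb emin]]|lb] := bottom_successor_or_limit b.
- by have := bbot a; rewrite leNgt ltab.
- have ae : (a <= e)%O.
    by rewrite leNgt; apply/negP => /emin; rewrite leNgt ltab.
  have aei := IH e eb ae.
  have ebi := iso_derivative_isometry (succS _ _ (ltW eb) (conj eb emin))
    (trivial_orbits_isometry aei ta).
  have := Existence.isometry_comp ebi aei.
  by congr is_isometry; apply/funext => x /=; exact: ds_proj_comp.
- apply: limit_proj_isometry => //; first exact: limS.
  by move=> e ae eb; exact: IH.
Qed.

Lemma countable_stationary_index X S : ~ countable [set: W] ->
  iso_derivatives X S ->
  exists (a a' : W) (aa' : (a <= a')%O),
    [/\ countable_ordinal a, is_successor a a' & is_isometry (ds_proj S aa')].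
Proof.
move=> Wunc XS; apply: contrapT => no.
have [|z _ zmin] := well_order_min Wwo (A := [set: W]).
  apply: contrapT => nW; apply: Wunc; apply: sub_countable (countable0 W).
  by apply: subset_card_le => w _; apply: nW; exists w.
have zbot : is_bottom z by move=> b; exact: zmin.
pose rho a x y := mdist (ds_proj S (zbot a) x) (ds_proj S (zbot a) y).
have rhoD a b x y : (a <= b)%O -> rho b x y <= rho a x y.
  move=> ab; rewrite /rho -!(ds_proj_comp (zbot a) ab (zbot b)).
  exact: ds_proj_nonexpansive.
apply: (uncountable_countable_ordinals Wwo Wunc).
apply: (strictly_decreasing_pseudometrics_countable (rho := rho)) => //.
- exact: cm_compact.
- by move=> a; exact: pseudometric_pullback.
- by move=> a x y; exact: ds_proj_nonexpansive.
move=> a ca; have [a' aa'] := countable_ordinal_successor Wwo Wunc ca.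
exists a'; split=> //; apply: contrapT => nlt; apply: no.
exists a, a', (ltW (proj1 aa')); split=> //; split=> [u v|]; last first.
  by have [_ succS _] := XS; have [] := succS _ _ (ltW (proj1 aa')) aa'.
have [x <-] := iso_derivatives_proj_surjective XS zbot (zbot a) u.
have [y <-] := iso_derivatives_proj_surjective XS zbot (zbot a) v.
apply: le_anti; rewrite ds_proj_nonexpansive /= !(ds_proj_comp _ _ (zbot a')).
rewrite leNgt; apply/negP => lt; apply: nlt; exists x, y; exact: lt.
Qed.

End Systems.

Theorem proposition5p5 (R : realType) :
  (forall (X : compactMetric R) (d : Order.disp_t) (W : orderType d)
      (S : directSystem R W),
    well_order (<=%O : rel W) -> ~ countable [set: W] ->
    iso_derivatives X S ->
    exists (a a' : W) (aa' : (a <= a')%O),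
      [/\ countable_ordinal a, is_successor a a' & is_isometry (ds_proj S aa')])
  /\
  (forall (X : compactMetric R) (d : Order.disp_t) (W : orderType d)
      (S : directSystem R W),
    well_order (<=%O : rel W) ->
    iso_derivatives X S ->
    forall (a a' : W) (aa' : (a <= a')%O),
      countable_ordinal a -> is_successor a a' -> is_isometry (ds_proj S aa') ->
      (forall (b c : W) (bc : (b <= c)%O), (a <= b)%O ->
         is_isometry (ds_proj S bc))
      /\ iso_rigid (S a)).
Proof.
split=> [X d W S Wwo Wunc XS|X d W S Wwo XS a a' aa' _ saa' isoaa'].
  exact: (countable_stationary_index Wwo Wunc XS).
have dera : is_iso_derivative (ds_proj S aa').
  by have [_ succS _] := XS; exact: succS.
have ta := iso_derivative_trivial_orbits dera isoaa'.
split=> [b c bc ab|]; last first.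
  by exists (S a'), (ds_proj S aa'); split=> //; exists (ds_proj S aa').
apply: (isometry_comp_cancelr (stationary_proj_isometry Wwo XS ta ab)).
have := stationary_proj_isometry Wwo XS ta (le_trans ab bc).
congr is_isometry; apply/funext => x /=.
by rewrite (ds_proj_comp ab bc (le_trans ab bc)).
Qed.
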